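(* If $\psi$ is a Boolean combination of formulas of the form $L_s\psi'$ (with arbitrary formulas $\psi'$ of $\mathcal{L}$ and indices $s\in\mathbb{Q}\cap[0,1]$), then for every rational $r$ with $0<r\le1$ and every formula $\phi$ of $\mathcal{L}$, the formula $(L_r\phi\wedge\psi)\leftrightarrow L_r(\phi\wedge\psi)$ is a theorem of $\Sigma_H$.
   Context: Language $\mathcal{L}$: formulas are given by $\phi ::= p \mid \neg\phi \mid \phi_1\wedge\phi_2 \mid L_r\phi$, with $p$ from a countably infinite set of propositional letters and $r\in\mathbb{Q}\cap[0,1]$. A logic is a set of formulas containing all propositional tautologies and closed under modus ponens and uniform substitution. $\Sigma_H$ is the smallest logic containing (A1) $L_0\phi$; (A2) $L_r\top$; (A3) $L_r(\phi\wedge\psi)\wedge L_t(\phi\wedge\neg\psi)\to L_{r+t}\phi$ for $r+t\le 1$; (A4) $\neg L_r(\phi\wedge\psi)\wedge\neg L_s(\phi\wedge\neg\psi)\to\neg L_{r+s}\phi$ for $r+s\le1$; (A5) $L_r\phi\to\neg L_s\neg\phi$ for $r+s>1$; $(4_p)$ $L_r\phi\to L_1L_r\phi$; $(5_p)$ $\neg L_r\phi\to L_1\neg L_r\phi$; and closed under (DIS): from $\phi\leftrightarrow\psi$ infer $L_r\phi\leftrightarrow L_r\psi$; and (ARCH): if $\gamma\to L_s\phi$ is a theorem for all $s<r$, then $\gamma\to L_r\phi$ is a theorem. All indices are rationals in $[0,1]$. *)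

(* Defs.v *)
From mathcomp Require Import all_boot all_order all_algebra.

Set Implicit Arguments.
Unset Strict Implicit.
Unset Printing Implicit Defensive.

Import Order.TTheory GRing.Theory Num.Theory.

Local Open Scope ring_scope.

Definition Lindex : Type := {r : rat | 0 <= r <= 1}.

Fact index0_subproof : 0 <= (0 : rat) <= 1.
Proof. by rewrite lexx ler01. Qed.

Fact index1_subproof : 0 <= (1 : rat) <= 1.
Proof. by rewrite ler01 lexx. Qed.

Definition index0 : Lindex := exist _ 0 index0_subproof.
Definition index1 : Lindex := exist _ 1 index1_subproof.

Inductive Lformula : Type :=
| Var of nat
| Neg of Lformula
| And of Lformula & Lformula
| L of Lindex & Lformula.

Definition Imp (phi psi : Lformula) : Lformula := Neg (And phi (Neg psi)).
Definition Iff (phi psi : Lformula) : Lformula := And (Imp phi psi) (Imp psi phi).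

(* The grammar has no constant for truth; any fixed tautology would do, since
   SigmaH is closed under replacement of equivalents below L (rule DIS). *)
Definition Top : Lformula := Neg (And (Var 0) (Neg (Var 0))).

Fixpoint Lsubst (sigma : nat -> Lformula) (phi : Lformula) : Lformula :=
  match phi with
  | Var n => sigma n
  | Neg phi1 => Neg (Lsubst sigma phi1)
  | And phi1 phi2 => And (Lsubst sigma phi1) (Lsubst sigma phi2)
  | L r phi1 => L r (Lsubst sigma phi1)
  end.

(* Classical truth value, where both the letters and the formulas L_r phi are
   treated as propositional atoms: v values the former and w the latter. *)
Fixpoint peval (v : nat -> bool) (w : Lindex -> Lformula -> bool) (phi : Lformula)
    : bool :=
  match phi with
  | Var n => v n
  | Neg phi1 => ~~ peval v w phi1
  | And phi1 phi2 => peval v w phi1 && peval v w phi2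
  | L r phi1 => w r phi1
  end.

Definition tautology (phi : Lformula) : Prop := forall v w, peval v w phi.

(* In A3 and A4 the variable u is an index, so that the equation
   val u = val r + val t carries the side condition r + t <= 1. *)
Inductive SigmaH : Lformula -> Prop :=
| SH_taut phi : tautology phi -> SigmaH phi
| SH_MP phi psi : SigmaH (Imp phi psi) -> SigmaH phi -> SigmaH psi
| SH_subst sigma phi : SigmaH phi -> SigmaH (Lsubst sigma phi)
| SH_A1 phi : SigmaH (L index0 phi)
| SH_A2 r : SigmaH (L r Top)
| SH_A3 (r t u : Lindex) phi psi : val u = val r + val t ->
    SigmaH (Imp (And (L r (And phi psi)) (L t (And phi (Neg psi)))) (L u phi))
| SH_A4 (r s u : Lindex) phi psi : val u = val r + val s ->
    SigmaH (Imp (And (Neg (L r (And phi psi))) (Neg (L s (And phi (Neg psi)))))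
                (Neg (L u phi)))
| SH_A5 (r s : Lindex) phi : 1 < val r + val s ->
    SigmaH (Imp (L r phi) (Neg (L s (Neg phi))))
| SH_4p r phi : SigmaH (Imp (L r phi) (L index1 (L r phi)))
| SH_5p r phi : SigmaH (Imp (Neg (L r phi)) (L index1 (Neg (L r phi))))
| SH_DIS r phi psi : SigmaH (Iff phi psi) -> SigmaH (Iff (L r phi) (L r psi))
| SH_ARCH (r : Lindex) gamma phi :
    (forall s : Lindex, val s < val r -> SigmaH (Imp gamma (L s phi))) ->
    SigmaH (Imp gamma (L r phi)).

Inductive L_combination : Lformula -> Prop :=
| LC_L s phi : L_combination (L s phi)
| LC_Neg psi : L_combination psi -> L_combination (Neg psi)
| LC_And psi1 psi2 :
    L_combination psi1 -> L_combination psi2 -> L_combination (And psi1 psi2).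

(* Main.v *)
Require Import Defs.
From mathcomp Require Import all_boot all_order all_algebra.

(** The idea: a Boolean combination [psi] of formulas [L s _] speaks only about
    the agent's own probabilities, and by the two introspection axioms the agent
    is certain of such facts.  Induction on [psi] gives both [psi -> L 1 psi] and
    [~ psi -> L 1 ~ psi] ([combination_certain]).

    From left to right, [psi] then has probability one, and intersecting with
    an event of probability one does not lower a probability
    ([L_And_certain]).  That lemma is where the infinitary rule ARCH enters:
    A5 bounds the probability of [phi /\ ~ psi] only by every positive rational,
    so additivity gives [L t (phi /\ psi)] for each [t < r] and not directly for
    [r].

    From right to left, [L r phi] follows by monotonicity ([L_mono]).  And if
    [psi] failed, its negation would have probability one, so [psi] could not
    have probability at least [r > 0]; this is A5 again
    ([certain_not_L_Neg]). *)

Import Order.TTheory GRing.Theory Num.Theory.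

Local Open Scope ring_scope.

Lemma SH_conseq1 a b : tautology (Imp a b) -> SigmaH a -> SigmaH b.
Proof. by move=> /SH_taut; apply: SH_MP. Qed.

Lemma SH_conseq2 a1 a2 b :
  tautology (Imp a1 (Imp a2 b)) -> SigmaH a1 -> SigmaH a2 -> SigmaH b.
Proof. by move=> tt /(SH_conseq1 _ _ tt); apply: SH_MP. Qed.

Lemma SH_conseq3 a1 a2 a3 b :
  tautology (Imp a1 (Imp a2 (Imp a3 b))) ->
  SigmaH a1 -> SigmaH a2 -> SigmaH a3 -> SigmaH b.
Proof. by move=> tt h1 h2; apply: SH_MP; apply: SH_conseq2 tt h1 h2. Qed.

Ltac truth_table :=
  let v := fresh "v" in let w := fresh "w" in
  move=> v w /=;
  repeat match goal with
  | |- context [peval v w ?f] => case: (peval v w f) => /=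
  | |- context [w ?r ?f] => case: (w r f) => /=
  end; done.

(** Since [phi] is equivalent to [chi /\ phi], this is A3 with the remainder
    [chi /\ ~ phi] bounded below by zero. *)
Lemma L_mono r phi chi : SigmaH (Imp phi chi) -> SigmaH (Imp (L r phi) (L r chi)).
Proof.
move=> hi.
have hiff : SigmaH (Iff phi (And chi phi)).
  by apply: SH_conseq1 hi; truth_table.
have r0 : val r = val r + val index0 by rewrite addr0.
apply: SH_conseq3 (SH_DIS r hiff) (SH_A1 (And chi (Neg phi)))
  (SH_A3 chi phi r0).
by truth_table.
Qed.

(** The strict inequality [1 < 1 + s] demanded by A5 is why [s] has to be
    positive. *)
Lemma certain_not_L_Neg (s : Lindex) psi : 0 < val s ->
  SigmaH (Imp (L index1 psi) (Neg (L s (Neg psi)))).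
Proof. by move=> s_gt0; apply: SH_A5; rewrite ltrDl. Qed.

Lemma L_And_certain r phi psi :
  SigmaH (Imp (And (L r phi) (L index1 psi)) (L r (And phi psi))).
Proof.
apply: SH_ARCH => t lt_tr.
(* The slack [r - t] is the bound used for the probability of [~ psi]. *)
have d_index : 0 <= val r - val t <= 1.
  rewrite subr_ge0 ltW //= lerBlDr.
  case/andP: (valP r) => _ r_le1; case/andP: (valP t) => t_ge0 _.
  by rewrite (le_trans r_le1) // lerDl.
pose d : Lindex := exist _ (val r - val t) d_index.
have d_gt0 : 0 < val d by rewrite subr_gt0.
have rE : val r = val t + val d by rewrite addrC subrK.
have small : SigmaH (Imp (L d (And phi (Neg psi))) (L d (Neg psi))).
  by apply: L_mono; apply: SH_taut; truth_table.
apply: SH_conseq3 small (certain_not_L_Neg d psi d_gt0) (SH_A4 phi psi rE).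
by truth_table.
Qed.

(** Both signs have to be carried through the induction, because negation
    exchanges them.  For a true conjunction the two certainties are combined by
    [L_And_certain]; a false one has a false conjunct, whose certain negation
    entails that of the conjunction. *)
Lemma combination_certain psi : L_combination psi ->
  SigmaH (Imp psi (L index1 psi)) /\ SigmaH (Imp (Neg psi) (L index1 (Neg psi))).
Proof.
elim=> [s phi|a _ [a_pos a_neg]|a b _ [a_pos a_neg] _ [b_pos b_neg]].
- by split; [exact: SH_4p | exact: SH_5p].
- split=> //.
  have dneg : SigmaH (Imp (L index1 a) (L index1 (Neg (Neg a)))).
    by apply: L_mono; apply: SH_taut; truth_table.
  by apply: SH_conseq2 a_pos dneg; truth_table.
- split.
    by apply: SH_conseq3 a_pos b_pos (L_And_certain index1 a b); truth_table.
  have weaken c : SigmaH (Imp (Neg c) (L index1 (Neg c))) ->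
      SigmaH (Imp (Neg c) (Neg (And a b))) ->
      SigmaH (Imp (Neg c) (L index1 (Neg (And a b)))).
    by move=> c_neg /(L_mono index1); apply: SH_conseq2 c_neg; truth_table.
  have left_false : SigmaH (Imp (Neg a) (L index1 (Neg (And a b)))).
    by apply: weaken a_neg _; apply: SH_taut; truth_table.
  have right_false : SigmaH (Imp (Neg b) (L index1 (Neg (And a b)))).
    by apply: weaken b_neg _; apply: SH_taut; truth_table.
  by apply: SH_conseq2 left_false right_false; truth_table.
Qed.

Theorem theorem3p13 (psi : Lformula) (hpsi : L_combination psi)
    (r : Lindex) (hr : 0 < val r) (phi : Lformula) :
  SigmaH (Iff (And (L r phi) psi) (L r (And phi psi))).
Proof.
have [pos neg] := combination_certain psi hpsi.
have to_right : SigmaH (Imp (And (L r phi) psi) (L r (And phi psi))).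
  by apply: SH_conseq2 pos (L_And_certain r phi psi); truth_table.
have to_phi : SigmaH (Imp (L r (And phi psi)) (L r phi)).
  by apply: L_mono; apply: SH_taut; truth_table.
have to_psi : SigmaH (Imp (L r (And phi psi)) psi).
  (* A5 for [~ psi] speaks of the double negation, which monotonicity absorbs. *)
  have dneg : SigmaH (Imp (L r (And phi psi)) (L r (Neg (Neg psi)))).
    by apply: L_mono; apply: SH_taut; truth_table.
  apply: SH_conseq3 neg dneg (certain_not_L_Neg r (Neg psi) hr).
  by truth_table.
by apply: SH_conseq3 to_right to_phi to_psi; truth_table.
Qed.
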